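(* For every odd integer $m \ge 3$, every integer $n \ge 50m$, and every tree $T_n$ on $n$ vertices, $R(T_n, C_m) = 2n - 1$.
   Context: All graphs are finite and simple. $C_m$ denotes the cycle of length $m$. For graphs $H$ and $K$, the Ramsey number $R(H,K)$ is the smallest positive integer $N$ such that for every graph $G$ with at least $N$ vertices, either $G$ contains a subgraph isomorphic to $H$ or the complement $\overline{G}$ contains a subgraph isomorphic to $K$. *)

(* Defs.v *)
From mathcomp Require Import all_boot.
Set Implicit Arguments. Unset Strict Implicit. Unset Printing Implicit Defensive.

Definition simple_graph (V : finType) (e : rel V) : Prop :=
  symmetric e /\ irreflexive e.

Definition compl_graph (V : finType) (e : rel V) : rel V :=
  fun x y => (x != y) && ~~ e x y.

Definition contains_copy (V W : finType) (h : rel V) (g : rel W) : Prop :=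
  exists f : V -> W, injective f /\ forall x y, h x y -> g (f x) (f y).

(* the cycle C_m on vertex set 'I_m (meaningful for m >= 3) *)
Definition cycle_graph (m : nat) : rel (ordinal m) :=
  fun i j => (val j == (val i).+1 %% m) || (val i == (val j).+1 %% m).
Arguments cycle_graph m : clear implicits.

Definition connected_graph (V : finType) (e : rel V) : Prop :=
  forall x y, connect e x y.

Definition acyclic_graph (V : finType) (e : rel V) : Prop :=
  forall k, 3 <= k -> ~ contains_copy (cycle_graph k) e.

Definition is_tree (V : finType) (e : rel V) : Prop :=
  [/\ simple_graph e, connected_graph e & acyclic_graph e].

Definition ramsey_prop (V1 V2 : finType) (H : rel V1) (K : rel V2) (N : nat)
  : Prop :=
  forall (W : finType) (G : rel W), simple_graph G -> N <= #|W| ->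
    contains_copy H G \/ contains_copy K (compl_graph G).

Definition ramsey_number_is (V1 V2 : finType) (H : rel V1) (K : rel V2)
  (N : nat) : Prop :=
  [/\ 0 < N, ramsey_prop H K N &
      forall N', 0 < N' -> ramsey_prop H K N' -> N <= N'].

(* Main.v *)
Require Import Defs.
From mathcomp Require Import all_boot zify.
Set Implicit Arguments. Unset Strict Implicit. Unset Printing Implicit Defensive.

(* Call the edges of G red and those of its complement blue, and let m = 2k+1.
   If there is no red tree, some vertex v has at least n blue neighbours; let A
   be n of them. Without a blue C_m, A contains no blue path on m - 1 vertices,
   so stopping a depth-first search of the blue graph on A leaves two sets of
   prescribed sizes with all edges between them red and at most m - 2 vertices
   of A outside them. A bipartite graph fits there except for m - 2 vertices,
   which have to be found among n - 1 vertices B outside A.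
   If 3n/4 vertices Y of B are each blue to more than two thirds of some S in A,
   then Y is joined by blue paths of every short even length. So Y is a red
   clique, the vertices with two blue neighbours in Y form another one, and the
   remaining vertices can be appended to Y to carry a red tree. Otherwise, for
   every S in A, many vertices of B are red to a third of S: hence almost every
   vertex of A has enough red neighbours in B to attach leaves there, and B has
   enough vertices on which to place vertices of degree at most 2. A tree has
   many leaves or many vertices of degree at most 2 with disjoint
   neighbourhoods. *)

(** * Cycles, injections and greedy choices in finite sets *)

Lemma compl_graph_sym (W : finType) (G : rel W) :
  symmetric G -> symmetric (compl_graph G).
Proof. by move=> Gsym x y; rewrite /compl_graph eq_sym Gsym. Qed.

Lemma cycle_copy (W : finType) (e : rel W) (s : seq W) :
  symmetric e -> 0 < size s -> uniq s -> cycle e s ->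
  contains_copy (cycle_graph (size s)) e.
Proof.
case: s => [//|x p] esym _ us cs.
have step (i : nat) : i < (size p).+1 ->
  e (nth x (x :: p) i) (nth x (x :: p) (i.+1 %% (size p).+1)).
  move=> ilt; have /(pathP x)/(_ i) := cs.
  rewrite size_rcons => /(_ ilt).
  rewrite -rcons_cons !nth_rcons /= ilt.
  case: ltnP => [ltSi|leSi]; first by rewrite modn_small.
  have -> : i = size p by lia.
  by rewrite eqxx modnn.
exists (fun i : 'I_(size p).+1 => nth x (x :: p) i); split.
  by move=> i j /eqP; rewrite nth_uniq //= => /eqP/val_inj.
move=> i j /orP[] /eqP ->; first exact: step.
by rewrite esym; apply: step.
Qed.

(** The points of [D] outside [D0] are listed and sent, in order, to the elements of [E] that [f0]
    leaves free. With [D0 = set0] this simply yields an injection of [D] into [E]. *)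
Lemma inj_extend (V W : finType) (D0 D : {set V}) (E : {set W}) (f0 : V -> W) :
  D0 \subset D -> {in D0 &, injective f0} -> {in D0, forall x, f0 x \in E} ->
  #|D| <= #|E| ->
  exists f, [/\ {in D0, f =1 f0}, {in D &, injective f} &
                {in D, forall x, f x \in E}].
Proof.
move=> sD inj0 in0 leDE.
pose R := enum (E :\: f0 @: D0); pose I := enum (D :\: D0).
have sub0 : f0 @: D0 \subset E by apply/subsetP => _ /imsetP[x xD ->]; exact: in0.
have szI : size I <= size R.
  rewrite -!cardE !cardsDS // card_in_imset //.
  exact: leq_sub2r.
have idx x : x \in D -> x \notin D0 -> index x I < size R.
  move=> xD xD0; apply: leq_trans szI.
  by rewrite index_mem /I mem_enum inE xD0.
pose f x := if x \in D0 then f0 x else nth (f0 x) R (index x I).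
have fR x : x \in D -> x \notin D0 -> f x \in E :\: f0 @: D0.
  move=> xD xD0; have := mem_nth (f0 x) (idx x xD xD0).
  by rewrite /f (negPf xD0) /R mem_enum.
have sep x y : x \in D -> x \notin D0 -> y \in D0 -> f x = f y -> False.
  move=> xD xD0 yD0 eqf; have := fR _ xD xD0.
  by rewrite eqf {1}/f yD0 inE imset_f.
exists f; split.
- by move=> x xD; rewrite /f xD.
- move=> x y xD yD eqf.
  case: (boolP (x \in D0)) => xD0; case: (boolP (y \in D0)) => yD0.
  + by apply: inj0 => //; move: eqf; rewrite /f xD0 yD0.
  + by case: (sep y x).
  + by case: (sep x y).
  + move: eqf; rewrite /f (negPf xD0) (negPf yD0).
    rewrite (set_nth_default (f0 y)) ?idx // => /eqP.
    rewrite nth_uniq ?enum_uniq ?idx // => /eqP eqi.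
    apply: (index_inj x _ _ eqi); last by rewrite /I mem_enum inE yD0.
    by rewrite /I mem_enum inE xD0.
- move=> x xD; case: (boolP (x \in D0)) => xD0; first by rewrite /f xD0 in0.
  by have := fR _ xD xD0; rewrite inE => /andP[].
Qed.

(* subset_leq_card, with the cardinals elaborated as cardinals of sets, which lia needs. *)
Lemma leq_card_subset (W : finType) (A B : {set W}) : A \subset B -> #|A| <= #|B|.
Proof. exact: subset_leq_card. Qed.

Lemma choose_subset (W : finType) (A : {set W}) r :
  r <= #|A| -> exists2 A' : {set W}, A' \subset A & #|A'| = r.
Proof.
move=> /card_geqP[s [us ss sA]].
exists [set x in s]; first by apply/subsetP => x; rewrite inE; exact: sA.
by rewrite cardsE (card_uniqP us).
Qed.

Lemma set_grow_ind (V : finType) (J : {set V}) (P : {set V} -> Prop) :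
  P set0 ->
  (forall (K : {set V}) w, K \subset J -> w \in J -> w \notin K -> P K -> P (w |: K)) ->
  P J.
Proof.
move=> P0 PS.
suff: forall r, r <= #|J| -> exists2 K : {set V}, K \subset J /\ #|K| = r & P K.
  case/(_ _ (leqnn _)) => K [sK cK] PK.
  suff <- : K = J by [].
  by apply/eqP; rewrite eqEcard sK cK leqnn.
elim=> [|r IH] ler; first by exists set0; rewrite ?sub0set ?cards0.
have [K [sK cK] PK] := IH (ltnW ler).
have /properP[_ [w wJ wK]] : K \proper J by rewrite properEcard sK cK.
exists (w |: K); last exact: PS.
by rewrite cardsU1 wK cK subUset sub1set wJ sK.
Qed.

Lemma greedy_choice (V W : finType) (J : {set V}) (C : V -> {set W}) (w0 : W) :
  {in J, forall j, #|J| <= #|C j|} ->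
  exists x : V -> W, {in J &, injective x} /\ {in J, forall j, x j \in C j}.
Proof.
move=> leC.
apply: (@set_grow_ind V J (fun K => exists x : V -> W,
  {in K &, injective x} /\ {in K, forall j, x j \in C j})).
  by exists (fun=> w0); split=> x; rewrite inE.
move=> K w sK wJ wK [x [xi xC]].
have ltKJ : #|K| < #|J|.
  by apply/proper_card/properP; split=> //; exists w.
have /subsetPn[z zC zK] : ~~ (C w \subset x @: K).
  apply: contraTN (leC w wJ) => /subset_leq_card le1; rewrite -ltnNge.
  by rewrite (leq_ltn_trans le1) // (leq_ltn_trans (leq_imset_card _ _)).
have xne j : j \in K -> x j != z by move=> jK; apply: contraNneq zK => <-; exact: imset_f.
exists (fun j => if j == w then z else x j); split=> [i j|j]; last first.
  by case: eqVneq => [->//|jw]; rewrite !inE (negPf jw) => /xC.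
rewrite !inE; case: eqVneq => [->|iw]; case: eqVneq => [->|jw] //= iK jK; last exact: xi.
- by move/esym/eqP; rewrite (negPf (xne _ _)).
- by move/eqP; rewrite (negPf (xne _ _)).
Qed.

Lemma clique_copy (V W : finType) (T : rel V) (G : rel W) (K : {set W}) :
  irreflexive T -> {in K &, forall x y, x != y -> G x y} -> #|V| <= #|K| ->
  0 < #|V| -> contains_copy T G.
Proof.
move=> Tirr clK leVK V0.
have /card_gt0P[w0 _] : 0 < #|K| by lia.
have [||||f [_ fi fK]] := @inj_extend V W set0 setT K (fun=> w0); rewrite ?sub0set ?cardsT //.
- by move=> x; rewrite inE.
- by move=> x; rewrite inE.
exists f; split=> [x y|x y Txy]; first by apply: fi; rewrite inE.
apply: clK; rewrite ?fK ?inE //.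
by apply: contraTneq Txy => /fi -> //; rewrite Tirr.
Qed.

(** * Growing a tree leaf by leaf: embeddings, colourings and degree sums *)

(** Connectedness provides an edge leaving any proper nonempty [K]. Its outer end [w] has only one
    neighbour in [K], because two of them, joined by a path inside [K], would close a cycle through
    [w]. The induction therefore also carries the connectedness of [K]. *)
Lemma tree_ind (V : finType) (T : rel V) (P : {set V} -> Prop) :
  is_tree T -> 0 < #|V| -> (forall r, P [set r]) ->
  (forall (K : {set V}) w u, w \notin K -> u \in K -> T w u ->
     (forall u', u' \in K -> T w u' -> u' = u) -> P K -> P (w |: K)) ->
  P setT.
Proof.
move=> [[Tsym Tirr] Tconn Tacyc] /card_gt0P[r _] P1 PS.
pose eK (K : {set V}) : rel V := fun x y => [&& T x y, x \in K & y \in K].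
have eKsym K : symmetric (eK K) by move=> x y; rewrite /eK Tsym [(x \in K) && _]andbC.
pose conn (K : {set V}) := {in K &, forall x y, connect (eK K) x y}.
suff: forall j, j < #|V| -> exists2 K : {set V}, #|K| = j.+1 & conn K /\ P K.
  case/(_ #|V|.-1); first by have := max_card (pred1 r); rewrite card1; lia.
  move=> K cK [_ PK]; suff <- : K = setT by [].
  apply/eqP; rewrite eqEcard subsetT cardsT cK; lia.
elim=> [|j IH] ltj.
  exists [set r]; first by rewrite cards1.
  by split=> // x y; rewrite !inE => /eqP-> /eqP->; exact: connect0.
have [K cK [connK PK]] := IH (ltnW ltj).
have [x xK] : exists x, x \in K by apply/card_gt0P; rewrite cK.
have [z zK] : exists z, z \notin K.
  apply/existsP; rewrite -negb_forall; apply: contraTN ltj => /forallP allK.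
  by rewrite -leqNgt -cK -cardsT; apply: subset_leq_card; apply/subsetP => y _; exact: allK.
have [w wK [u uK Twu]] : exists2 w, w \notin K & exists2 u, u \in K & T w u.
  case: (boolP [exists w in ~: K, [exists u in K, T w u]]) => [/exists_inP[w]|noedge].
    by rewrite inE => wK /exists_inP[u uK Twu]; exists w => //; exists u.
  have clK : closed T (mem K).
    move=> a b Tab; apply/idP/idP => [aK|bK]; apply: contraNT noedge => nK.
      by apply/exists_inP; exists b; rewrite ?inE //; apply/exists_inP; exists a; rewrite // Tsym.
    by apply/exists_inP; exists a; rewrite ?inE //; apply/exists_inP; exists b.
  by have : (x \in K) = (z \in K) := closed_connect clK (Tconn x z); rewrite xK (negPf zK).
exists (w |: K); first by rewrite cardsU1 wK cK.
have uniqu u' : u' \in K -> T w u' -> u' = u.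
  move=> u'K Twu'; apply/eqP; apply/negPn/negP => neq.
  have /connectP[p pth lastp] := connK _ _ uK u'K.
  case/shortenP: pth lastp => q pq uq _ lastq.
  have qK : all (mem K) (u :: q).
    apply/allP => y; rewrite !inE => /orP[/eqP->//|yq].
    have /(path_sorted) := pq.
    elim: q u {uK Twu neq lastq uq} pq yq => //= a q IHq b /andP[/and3P[_ _ aK] pq].
    by rewrite inE => /orP[/eqP->//|yq _]; apply: (IHq a) => //; exact: path_sorted pq.
  (* The path from [u] to [u'] has an edge, so that the cycle [w :: u :: q] has length at least
     3. *)
  have sq : 0 < size q.
    by case: (q) lastq neq => //= ->; rewrite eqxx.
  apply: (Tacyc (size (w :: u :: q))); first by rewrite /= !ltnS.
  apply: cycle_copy => //=.
    rewrite -/(uniq (u :: q)) uq andbT; apply: contraNN wK => wq.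
    by move/allP: qK => /(_ w wq).
  rewrite rcons_path Twu -lastq Tsym Twu' andbT /=.
  by apply: sub_path pq => a b /and3P[].
split; last exact: (PS K w u).
have sub : subrel (connect (eK K)) (connect (eK (w |: K))).
  apply: connect_sub => a b /and3P[Tab aK bK]; apply: connect1.
  by rewrite /eK Tab !inE aK bK !orbT.
have wu : connect (eK (w |: K)) w u.
  by apply: connect1; rewrite /eK Twu !inE eqxx uK orbT.
have csym := sym_connect_sym (eKsym (w |: K)).
move=> x' y'; rewrite !inE => /orP[/eqP->|xK'] /orP[/eqP->|yK'].
- exact: connect0.
- exact: connect_trans wu (sub _ _ (connK _ _ uK yK')).
- by rewrite csym; apply: connect_trans wu (sub _ _ (connK _ _ uK xK')).
- exact: sub (connK _ _ xK' yK').
Qed.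

Definition deg (V : finType) (T : rel V) (x : V) := #|[set y | T x y]|.

Lemma greedy_embedding (V W : finType) (T : rel V) (G : rel W) :
  is_tree T -> simple_graph G -> 0 < #|V| -> 0 < #|W| ->
  (forall w, #|V| <= (deg G w).+1) -> contains_copy T G.
Proof.
move=> Ttree [Gsym Girr] V0 W0 degG.
have /card_gt0P[w0 _] := W0.
pose P (K : {set V}) := exists f : V -> W,
  {in K &, injective f} /\ {in K &, forall x y, T x y -> G (f x) (f y)}.
have [[Tsym Tirr] _ _] := Ttree.
suff [f [fi fT]] : P setT.
  by exists f; split=> [x y|x y]; [apply: fi|apply: fT]; rewrite inE.
apply: (tree_ind Ttree V0) => [r|K w u wK uK Twu uniqu [f [fi fT]]].
  exists (fun=> w0); split=> x y; rewrite !inE => /eqP-> /eqP-> //.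
  by rewrite Tirr.
(* Since [f u] is not adjacent to itself, only the images of [K :\ u] can block a neighbour of
   [f u]. These are at most $|V| - 2$, so degree $|V| - 1$ is enough. *)
have [z] : exists z, z \in [set z | G (f u) z] :\: f @: (K :\ u).
  apply/card_gt0P; rewrite cardsD subn_gt0.
  apply: leq_ltn_trans (subset_leq_card (subsetIr _ _)) _.
  apply: leq_ltn_trans (leq_imset_card _ _) _.
  have := degG (f u); rewrite /deg; have := cardsD1 u K; rewrite uK.
  have := max_card (mem (w |: K)); rewrite cardsU1 wK; lia.
rewrite !inE => /andP[zK Gz].
have zK' x : x \in K -> f x != z.
  move=> xK; apply: contraNneq zK => eqz.
  rewrite -eqz imset_f // !inE xK andbT.
  by apply: contraTneq Gz => <-; rewrite -eqz Girr.
exists (fun x => if x == w then z else f x); split.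
  move=> x y; rewrite !inE; case: eqVneq => [->|xw]; case: eqVneq => [->|yw] //= xK yK.
  - by move/esym/eqP; rewrite (negPf (zK' _ yK)).
  - by move/eqP; rewrite (negPf (zK' _ xK)).
  - exact: fi.
move=> x y; rewrite !inE; case: eqVneq => [->|xw]; case: eqVneq => [->|yw] //= xK yK.
- by rewrite Tirr.
- by move/(uniqu _ yK) => ->; rewrite Gsym.
- by rewrite Tsym => /(uniqu _ xK) ->.
- exact: fT.
Qed.

Lemma tree_coloring (V : finType) (T : rel V) :
  is_tree T -> 0 < #|V| -> exists c : V -> bool, forall x y, T x y -> c x != c y.
Proof.
move=> Ttree V0; have [[Tsym Tirr] _ _] := Ttree.
pose P (K : {set V}) := exists c : V -> bool, {in K &, forall x y, T x y -> c x != c y}.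
suff [c cP] : P setT.
  by exists c => x y; apply: cP; rewrite inE.
apply: (tree_ind Ttree V0) => [r|K w u wK uK Twu uniqu [c cP]].
  by exists xpredT => x y; rewrite !inE => /eqP-> /eqP->; rewrite Tirr.
exists (fun x => if x == w then ~~ c u else c x).
move=> x y; rewrite !inE; case: eqVneq => [->|xw]; case: eqVneq => [->|yw] //= xK yK.
- by rewrite Tirr.
- by move/(uniqu _ yK) => ->; case: (c u).
- by rewrite Tsym => /(uniqu _ xK) ->; case: (c u).
- exact: cP.
Qed.

(** Every edge has exactly one end in the class [b], so the degrees over that class count each of
    the $|V| - 1$ edges once. *)
Lemma tree_color_degree (V : finType) (T : rel V) (c : V -> bool) (b : bool) :
  is_tree T -> 0 < #|V| -> (forall x y, T x y -> c x != c y) ->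
  (\sum_(x | c x == b) deg T x).+1 = #|V|.
Proof.
move=> Ttree V0 cP; have [[Tsym Tirr] _ _] := Ttree.
pose P (K : {set V}) :=
  (\sum_(x in K) (c x == b) * \sum_(y in K) T x y).+1 = #|K|.
suff : P setT.
  rewrite /P cardsT => <-; congr _.+1; rewrite big_mkcond /= [RHS]big_mkcond /=.
  apply: eq_bigr => x _; rewrite inE; case: (c x == b) => //=.
  rewrite mul1n /deg -sum1_card big_mkcond [RHS]big_mkcond /=.
  by apply: eq_bigr => y _; rewrite !inE; case: (T x y).
apply: (tree_ind Ttree V0) => [r|K w u wK uK Twu uniqu].
  by rewrite /P !big_set1 Tirr muln0 cards1.
rewrite /P cardsU1 wK => <-; rewrite big_setU1 //= big_setU1 //= Tirr.
have Tw (F : V -> nat) : \sum_(y in K) F y * T w y = F u.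
  rewrite (bigD1 u) //= Twu muln1 big1 ?addn0 // => y /andP[yK yu].
  case E: (T w y); rewrite ?muln0 //.
  by move/uniqu: E => /(_ yK) E; rewrite E eqxx in yu.
have -> : \sum_(y in K) T w y = 1.
  by rewrite -(Tw (fun=> 1)); apply: eq_bigr => y _; rewrite mul1n.
have -> : \sum_(x in K) (c x == b) * \sum_(y in w |: K) T x y =
  (c u == b) + \sum_(x in K) (c x == b) * \sum_(y in K) T x y.
  rewrite -(Tw (fun x => nat_of_bool (c x == b))) -big_split /=.
  by apply: eq_bigr => x xK; rewrite big_setU1 //= mulnDr Tsym.
have := cP _ _ Twu; by case: (c w) (c u) {P} b => [] [] [] //= _; rewrite ?mul1n ?mul0n; lia.
Qed.

Lemma tree_deg_gt0 (V : finType) (T : rel V) x : is_tree T -> 1 < #|V| -> 0 < deg T x.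
Proof.
move=> [_ Tconn _] V1.
have [y yx] : exists y, y \in [set~ x] by apply/card_gt0P; rewrite cardsC1; lia.
have /connectP[[|z p] /= pth lastp] := Tconn x y.
  by move: yx; rewrite lastp !inE eqxx.
by case/andP: pth => Txz _; apply/card_gt0P; exists z; rewrite inE.
Qed.

(** * Depth-first splits and the gluing of partial embeddings *)

(* The two sides are the finished and the unvisited vertices of a depth-first
   search, stopped when exactly f vertices are finished; the remaining vertices
   form the search stack, which is a path. *)
Lemma dfs_split (W : finType) (e : rel W) (A : {set W}) (r f : nat) :
  symmetric e ->
  (forall s : seq W, uniq s -> {subset s <= A} -> sorted e s -> size s <= r) ->
  f <= #|A| ->
  exists F U : {set W}, [/\ F \subset A, U \subset A, [disjoint F & U], #|F| = f
    & #|A| <= f + #|U| + r /\ {in F & U, forall x y, ~~ e x y}].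
Proof.
move=> esym short.
pose U (F : {set W}) (s : seq W) := A :\: (F :|: [set x in s]).
pose state f (F : {set W}) (s : seq W) := [/\ F \subset A /\ #|F| = f,
  uniq s, {subset s <= A} & [/\ sorted e s, {in s, forall x, x \notin F}
  & {in F & U F s, forall x y, ~~ e x y}]].
suff main : f <= #|A| -> exists F s, state f F s.
  case/main => F [s [[sF cF] us sA [pths disj sep]]].
  exists F, (U F s); split=> //; first exact: subsetDl.
    rewrite -setI_eq0; apply/eqP/setP => x; rewrite !inE.
    by case: (x \in F); rewrite ?andbF.
  split=> //; have := short s us sA pths.
  have : #|[set x in s]| = size s by rewrite cardsE (card_uniqP us).
  have := cardsID (F :|: [set x in s]) A; rewrite -/(U F s).
  have := leq_card_subset (subsetIr A (F :|: [set x in s])).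
  have := (leq_card_setU F [set x in s]).1; rewrite cF; lia.
elim: f => [|f IH] ltf.
  exists set0, [::]; split=> //; first by rewrite sub0set cards0.
  by split=> // x y; rewrite inE.
have [F [s]] := IH (ltnW ltf).
(* Inner induction on the number of unvisited vertices: pushing one onto the stack lowers it, while
   finishing the top of the stack reaches the count [f.+1] at once. *)
have [d] := ubnP #|U F s|; elim: d F s => // d IHd F s ltd.
move=> [[sF cF] us sA [pths disj sep]].
have push y : y \in U F s -> sorted e (y :: s) -> exists F s, state f.+1 F s.
  move=> yU pys; have := yU; rewrite !inE negb_or => /andP[/andP[yF ys] yA].
  have sub : U F (y :: s) \subset U F s :\ y.
    apply/subsetP => x; rewrite !inE !negb_or => /andP[/and3P[-> -> ->] ->].
    by [].
  apply: (IHd F (y :: s)).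
    have := leq_card_subset sub; have := cardsD1 y (U F s); rewrite yU; lia.
  split=> //; first by rewrite /= ys.
    by move=> x; rewrite inE => /orP[/eqP->//|]; exact: sA.
  split=> //.
    by move=> x; rewrite inE => /orP[/eqP->//|]; exact: disj.
  move=> x z xF zU; apply: sep => //.
  by have := subsetP sub z zU; rewrite in_setD1 => /andP[].
case: s us sA pths disj sep ltd push => [|x p] us sA pths disj sep ltd push.
  have [y yU] : exists y, y \in U F [::].
    apply/card_gt0P; rewrite /U cardsD.
    have -> : A :&: (F :|: [set x in [::]]) = F.
      by apply/setP => z; rewrite !inE orbF andb_idl //; exact: (subsetP sF).
    lia.
  exact: push yU isT.
case: (boolP [exists y in U F (x :: p), e y x]) => [/exists_inP[y yU eyx]|].
  by apply: push yU _; rewrite /= eyx.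
move=> /exists_inPn noext.
have xF : x \notin F by apply: disj; exact: mem_head.
move: us => /= /andP[xp up].
exists (x |: F), p; split=> //.
- rewrite subUset sub1set sA ?mem_head // sF; split=> //.
  by rewrite cardsU1 xF cF.
- by move=> y yp; apply: sA; rewrite inE yp orbT.
split=> //.
- exact: path_sorted pths.
- move=> y yp; rewrite !inE negb_or disj ?inE ?yp ?orbT // andbT.
  by apply: contraNneq xp => <-.
move=> z y; rewrite !inE negb_or => /orP[/eqP->|zF] /andP[/andP[/norP[yx yF] yp] yA].
  rewrite esym; apply: noext; rewrite !inE !negb_or yF yx yp /=.
  by [].
by apply: sep => //; rewrite !inE !negb_or yF yx yp.
Qed.

Lemma patch_copy (V W : finType) (T : rel V) (G : rel W) (J : {set V})
    (D E : {set W}) (f x : V -> W) :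
  symmetric T -> symmetric G -> [disjoint D & E] ->
  {in J &, forall i j, ~~ T i j} ->
  {in ~: J &, injective f} -> {in ~: J, forall u, f u \in E} ->
  {in ~: J &, forall u v, T u v -> G (f u) (f v)} ->
  {in J &, injective x} -> {in J, forall j, x j \in D} ->
  (forall j u, j \in J -> T j u -> G (x j) (f u)) ->
  contains_copy T G.
Proof.
move=> Tsym Gsym dis ind fi fE fT xi xD xf.
have inC u : u \notin J -> u \in ~: J by rewrite inE.
have sep j u : j \in J -> u \notin J -> x j <> f u.
  move=> jJ uJ eqx; have /setP/(_ (x j)) := disjoint_setI0 dis.
  by rewrite !inE xD // eqx fE ?inE.
exists (fun v => if v \in J then x v else f v); split=> [u v|u v].
  case: (boolP (u \in J)) => uJ; case: (boolP (v \in J)) => vJ.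
  - exact: xi.
  - by move/(sep _ _ uJ vJ).
  - by move/esym/(sep _ _ vJ uJ).
  - by apply: fi; exact: inC.
case: (boolP (u \in J)) => uJ; case: (boolP (v \in J)) => vJ Tuv.
- by case/negP: (ind _ _ uJ vJ).
- exact: xf.
- by rewrite Gsym; apply: xf; rewrite // Tsym.
- by apply: fT => //; exact: inC.
Qed.

(* J lies in the colour class c = b; the rest of that class is placed in U and
   the other class in F. *)
Lemma bipartite_copy (V W : finType) (T : rel V) (G : rel W) (c : V -> bool)
    (b : bool) (J : {set V}) (F U D : {set W}) (f x : V -> W) :
  symmetric T -> symmetric G -> (forall u v, T u v -> c u != c v) ->
  J \subset [set v | c v == b] ->
  [disjoint F & U] -> [disjoint D & F :|: U] ->
  {in F & U, forall y z, G y z} ->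
  #|[set v | c v == b] :\: J| <= #|U| ->
  {in [set v | c v != b] &, injective f} ->
  {in [set v | c v != b], forall v, f v \in F} ->
  {in J &, injective x} -> {in J, forall j, x j \in D} ->
  (forall j u, j \in J -> T j u -> G (x j) (f u)) ->
  contains_copy T G.
Proof.
move=> Tsym Gsym cP /subsetP sJ disFU disD GFU leU fi fF xi xD xf.
have [||||g [_ gi gU]] := @inj_extend V W set0 ([set v | c v == b] :\: J) U f;
  rewrite ?sub0set //; try by move=> u; rewrite inE.
have FUn y : y \in F -> y \in U -> False.
  by move=> yF yU; have /setP/(_ y) := disjoint_setI0 disFU; rewrite !inE yF yU.
pose h v := if c v == b then g v else f v.
have hg v : v \in ~: J -> c v == b -> v \in [set v | c v == b] :\: J.
  by rewrite !inE => -> ->.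
have neb v : c v != b -> v \in [set v | c v != b] by rewrite inE.
apply: (@patch_copy V W T G J D (F :|: U) h x) => //.
- move=> i j /sJ; rewrite inE => /eqP ci /sJ; rewrite inE => /eqP cj.
  by apply/negP => /cP; rewrite ci cj eqxx.
- move=> u v uJ vJ; rewrite /h.
  case: (boolP (c u == b)) => cu; case: (boolP (c v == b)) => cv eqh.
  + by apply: gi eqh; apply: hg.
  + by case: (@FUn (f v)); rewrite ?fF ?neb // -eqh gU ?hg.
  + by case: (@FUn (f u)); rewrite ?fF ?neb // eqh gU ?hg.
  + by apply: fi eqh; apply: neb.
- move=> u uJ; rewrite /h inE; case: (boolP (c u == b)) => cu.
    by rewrite gU ?hg ?orbT.
  by rewrite fF ?neb.
- move=> u v uJ vJ Tuv; rewrite /h; have := cP _ _ Tuv.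
  case: (boolP (c u == b)) => cu; case: (boolP (c v == b)) => cv.
  + by rewrite (eqP cu) (eqP cv) eqxx.
  + by move=> _; rewrite Gsym GFU ?fF ?gU ?hg ?neb.
  + by move=> _; rewrite GFU ?fF ?gU ?hg ?neb.
  + by move: cu cv; case: (c u); case: (c v); case: (b).
- move=> j u jJ Tju; rewrite /h; have := sJ _ jJ; rewrite inE => /eqP cj.
  by have := cP _ _ Tju; rewrite cj eq_sym => /negPf ->; apply: xf.
Qed.

(** * Even paths, degree counts in trees and the robust case *)

(** The path alternates between [Y] and [S]: go from [y] through a common neighbour [s] to a fresh
    [y1] in [Y], delete [y] and [s], and continue from [y1]. Deleting [s] costs each pair at most
    one common neighbour, which matches the decrease of [j]. *)
Lemma even_path (W : finType) (e : rel W) (j : nat) (Y S : {set W}) (y y' : W) :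
  symmetric e -> [disjoint Y & S] -> y \in Y -> y' \in Y -> y != y' ->
  0 < j -> j < #|Y| ->
  {in Y &, forall u v, u != v -> j <= #|[set s in S | e u s && e v s]|} ->
  exists p, [/\ path e y p, last y p = y', uniq (y :: p), size p = j.*2 &
                {subset p <= Y :|: S}].
Proof.
move=> esym; elim: j Y S y => [//|j IH] Y S y disYS yY y'Y neq _ ltY com.
have YSn z : z \in Y -> z \in S -> False.
  by move=> zY zS; have /setP/(_ z) := disjoint_setI0 disYS; rewrite !inE zY zS.
case: (posnP j) => [j0|j_gt0].
  have /card_gt0P[s] : 0 < #|[set s in S | e y s && e y' s]|.
    by apply: leq_trans (com _ _ yY y'Y neq).
  rewrite inE => /and3P[sS eys ey's].
  exists [:: s; y']; split=> //=.
  - by rewrite eys esym ey's.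
  - rewrite !inE negb_or neq !andbT.
    by apply/andP; split; apply/negP => /eqP E; [apply: (YSn y)|apply: (YSn y')]; rewrite // ?E // -E.
  - by rewrite j0.
  - by move=> z; rewrite !inE => /orP[]/eqP->; rewrite ?sS ?y'Y ?orbT.
have /card_gt0P[y1] : 0 < #|Y :\ y :\ y'|.
  have := cardsD1 y Y; have := cardsD1 y' (Y :\ y).
  by rewrite !inE eq_sym neq yY y'Y /=; lia.
rewrite !inE => /and3P[y1y' y1y y1Y].
have /card_gt0P[s] : 0 < #|[set s in S | e y s && e y1 s]|.
  by apply: leq_trans (com _ _ yY y1Y _); rewrite // eq_sym.
rewrite inE => /and3P[sS eys ey1s].
have [|||||||p [pp lp up sp subp]] := IH (Y :\ y) (S :\ s) y1; rewrite ?inE ?y1y ?y1Y ?y'Y ?andbT //.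
- by apply: disjointWl (subsetDl _ _) _; apply: disjointWr (subsetDl _ _) _.
- by rewrite eq_sym.
- by have := cardsD1 y Y; rewrite yY; lia.
- move=> u v; rewrite !inE => /andP[_ uY] /andP[_ vY] uv.
  have := com _ _ uY vY uv; rewrite (cardsD1 s).
  set N := _ :\ s; set M := [set z in S :\ s | _].
  suff /leq_card_subset le1 : N \subset M.
    by case: (_ \in _) => le2; apply: leq_trans le1; rewrite // ltnW.
  by apply/subsetP => z; rewrite !inE => /andP[-> /andP[-> ->]].
have nps z : z \in y1 :: p -> (z != y) && (z != s).
  rewrite inE => /orP[/eqP->|/subp].
    by rewrite y1y; apply/eqP => E; apply: (YSn y1); rewrite // E.
  rewrite !inE => /orP[/andP[-> zY]|/andP[-> zS]] //=; rewrite ?andbT.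
    by apply/eqP => E; apply: (YSn s); rewrite // -E.
  by apply/eqP => E; apply: (YSn z); rewrite // E.
exists [:: s, y1 & p]; split.
- by rewrite /= eys esym ey1s.
- by [].
- rewrite [uniq _]/= -/(uniq (y1 :: p)) up andbT.
  apply/andP; split.
    rewrite in_cons negb_or; apply/andP; split.
      by apply/eqP => E; apply: (YSn s); rewrite // -E.
    by apply/negP => /nps; rewrite eqxx.
  by apply/negP => /nps; rewrite eqxx andbF.
- by rewrite /= sp.
- move=> z; rewrite !inE => /or3P[/eqP->|/eqP->|/subp].
  + by rewrite sS orbT.
  + by rewrite y1Y.
  + by rewrite !inE => /orP[]/andP[_ ->]; rewrite ?orbT.
Qed.

Definition nbhd (V : finType) (T : rel V) (J : {set V}) :=
  \bigcup_(j in J) [set u | T j u].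

Lemma nbhdP (V : finType) (T : rel V) (J : {set V}) u :
  reflect (exists2 j, j \in J & T j u) (u \in nbhd T J).
Proof.
apply: (iffP bigcupP) => [[j jJ]|[j jJ Tju]]; last by exists j; rewrite ?inE.
by rewrite inE; exists j.
Qed.

Lemma leq_card_bigcup (I W : finType) (J : {set I}) (F : I -> {set W}) :
  #|\bigcup_(i in J) F i| <= \sum_(i in J) #|F i|.
Proof.
elim/big_rec2: _ => [|i A n iJ leA]; first by rewrite cards0.
by apply: leq_trans (leq_card_setU _ _).1 _; rewrite leq_add2l.
Qed.

Lemma leq_card_bigcup_const (I W : finType) (J : {set I}) (F : I -> {set W}) d :
  {in J, forall i, #|F i| <= d} -> #|\bigcup_(i in J) F i| <= d * #|J|.
Proof.
move=> leF; rewrite mulnC -sum_nat_const.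
by apply: leq_trans (leq_card_bigcup _ _) _; apply: leq_sum.
Qed.

(** Over the integers the sum of $\deg x - 2$ is $-2$. A leaf contributes $-1$ there but 0 under the
    truncated subtraction, so the truncated sum is the number of leaves minus 2. *)
Lemma tree_leaf_count (V : finType) (T : rel V) :
  is_tree T -> 1 < #|V| ->
  (\sum_x (deg T x - 2)).+2 = #|[set x | deg T x <= 1]|.
Proof.
move=> Ttree V1; have V0 := ltnW V1.
have [c cP] := tree_coloring Ttree V0.
have sumdeg : (\sum_x deg T x).+2 = 2 * #|V|.
  rewrite (bigID (fun x => c x == true)) /=.
  have -> : \sum_(x | c x != true) deg T x = \sum_(x | c x == false) deg T x.
    by apply: eq_bigl => x; case: (c x).
  by rewrite -addnS -addSn !tree_color_degree // addnn mul2n.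
have : \sum_x deg T x + \sum_x (deg T x <= 1) = 2 * #|V| + \sum_x (deg T x - 2).
  have -> : 2 * #|V| = \sum_(x : V) 2 by rewrite sum_nat_const mulnC.
  rewrite -!big_split /=; apply: eq_bigr => x _.
  by have := tree_deg_gt0 x Ttree V1; case: leqP => /=; lia.
have -> : \sum_x (deg T x <= 1) = #|[set x | deg T x <= 1]|.
  by rewrite -sum1_card [RHS]big_mkcond; apply: eq_bigr => x _; rewrite inE; case: leqP.
lia.
Qed.

Lemma tree_branch_count (V : finType) (T : rel V) :
  is_tree T -> 1 < #|V| ->
  #|[set x | 2 < deg T x]| + 2 <= #|[set x | deg T x <= 1]|.
Proof.
move=> Ttree V1; rewrite -tree_leaf_count // addn2 !ltnS.
rewrite -sum1_card big_mkcond /=; apply: leq_sum => x _.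
by rewrite inE; case: ltnP => //; lia.
Qed.

(** Vertices of degree above 2 are outnumbered by leaves, so at least half of all vertices have
    degree at most 2, and one of the two colours holds at least half of these. *)
Lemma low_degree_class (V : finType) (T : rel V) (c : V -> bool) :
  is_tree T -> 1 < #|V| ->
  exists b, #|V| <= 4 * #|[set x | (c x == b) && (deg T x <= 2)]|.
Proof.
move=> Ttree V1; have le1 := tree_branch_count Ttree V1.
pose L := [set x | deg T x <= 2].
have le2 : #|[set x | deg T x <= 1]| <= #|L|.
  by apply: leq_card_subset; apply/subsetP => x; rewrite !inE; lia.
have cL : #|L| + #|[set x | 2 < deg T x]| = #|V|.
  have -> : [set x | 2 < deg T x] = ~: L by apply/setP => x; rewrite !inE ltnNge.
  exact: cardsC.
have LE b : L :&: [set x | c x == b] = [set x | (c x == b) && (deg T x <= 2)].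
  by apply/setP => x; rewrite !inE andbC.
have cc : #|[set x | (c x == true) && (deg T x <= 2)]| +
   #|[set x | (c x == false) && (deg T x <= 2)]| = #|L|.
  have -> : [set x | (c x == false) && (deg T x <= 2)] = L :\: [set x | c x == true].
    by apply/setP => x; rewrite !inE; case: (c x).
  by rewrite -LE; apply: cardsID.
case: (leqP #|V| (4 * #|[set x | (c x == true) && (deg T x <= 2)]|)) => le.
  by exists true.
by exists false; lia.
Qed.

(* Any two vertices of Y are joined by blue paths with 2k - 2 and with 2k edges
   (even_path), so a blue edge inside Y or inside Z closes a blue cycle of length
   2k + 1. The set Z has fewer than #|V| vertices, which leaves enough vertices
   with at most one blue neighbour in Y to complete Y to a copy of T. *)
Lemma robust_clique (V W : finType) (T : rel V) (G : rel W) (k : nat)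
    (Y S : {set W}) :
  is_tree T -> simple_graph G -> 1 < #|V| -> 1 < k -> 2 * #|V| - 1 <= #|W| ->
  [disjoint Y & S] -> k < #|Y| -> 3 * #|V| <= 4 * #|Y| ->
  {in Y &, forall u v, u != v ->
     k.+2 <= #|[set s in S | compl_graph G u s && compl_graph G v s]|} ->
  contains_copy T G \/ contains_copy (cycle_graph k.*2.+1) (compl_graph G).
Proof.
move=> Ttree [Gsym Girr] V1 k1 leW disYS ltkY le34 com.
have [[Tsym Tirr] _ _] := Ttree.
set B := compl_graph G in com *; have Bsym : symmetric B := compl_graph_sym Gsym.
have BG x y : x != y -> ~~ B x y -> G x y.
  by rewrite /B /compl_graph => -> /=; rewrite negbK.
have Bneq x y : B x y -> x != y by case/andP.
clearbody B.
have V0 := ltnW V1.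
case: (boolP [exists u in Y, [exists v in Y, B u v]]) => [|/exists_inPn noY].
  case/exists_inP=> u uY /exists_inP[v vY Buv]; right.
  have uv : u != v := Bneq _ _ Buv.
  have [|a b aY bY ab|p [pp lp up sp subp]] := @even_path W B k Y S u v Bsym disYS uY vY uv _ ltkY.
  - exact: ltnW.
  - by apply: leq_trans (com _ _ aY bY ab); rewrite ltnW.
  rewrite -sp -[(size p).+1]/(size (u :: p)).
  by apply: cycle_copy => //=; rewrite rcons_path pp lp Bsym.
have clY : {in Y &, forall x y, x != y -> G x y}.
  by move=> x y xY yY /BG; apply; have /exists_inPn := noY x xY; apply.
pose Z := [set z in ~: Y | 1 < #|[set y in Y | B z y]|].
case: (boolP [exists z in Z, [exists z' in Z, B z z']]) => [|/exists_inPn noZ].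
  case/exists_inP=> z; rewrite !inE => /andP[zY z2].
  case/exists_inP=> z'; rewrite !inE => /andP[z'Y z'2] Bzz'; right.
  have zz' : z != z' := Bneq _ _ Bzz'.
  have /card_gt0P[y] : 0 < #|[set y in Y | B z y]| by apply: ltnW.
  rewrite inE => /andP[yY Bzy].
  have /card_gt0P[y'] : 0 < #|[set y in Y | B z' y] :\ y|.
    by move: z'2; rewrite (cardsD1 y); case: (_ \in _) => //=; lia.
  rewrite !inE => /and3P[y'y y'Y Bz'y'].
  have dis' : [disjoint Y & S :\ z :\ z'].
    by apply: disjointWr disYS; apply: subset_trans (subsetDl _ _) (subsetDl _ _).
  have yy' : y != y' by rewrite eq_sym.
  (* A path with $2k - 2$ edges from [y] to [y'] closes up with the three edges through [z] and
     [z']. These two vertices may lie in [S]; removing them costs a pair at most two of its [k.+2]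
     common neighbours. *)
  have [||a b aY bY ab|p [pp lp up sp subp]] :=
    @even_path W B k.-1 Y (S :\ z :\ z') y y' Bsym dis' yY y'Y yy'.
  - by case: (k) k1 => [|[]].
  - exact: leq_ltn_trans (leq_pred k) ltkY.
  - have := com _ _ aY bY ab.
    set M := [set s in S | _].
    have -> : [set s in S :\ z :\ z' | B a s && B b s] = M :\ z :\ z'.
      by apply/setP => t; rewrite !inE; case: (t == z'); case: (t == z).
    rewrite (cardsD1 z M) (cardsD1 z' (M :\ z)).
    move: #|M :\ z :\ z'| => q.
    by case: (_ \in _); case: (_ \in _); clear; lia.
  have nz t : t \in y :: p -> (t != z) && (t != z').
    rewrite inE => /orP[/eqP->|/subp].
      by apply/andP; split; apply/eqP => E; move: zY z'Y; rewrite -E yY.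
    rewrite !inE => /orP[tY|/and3P[-> -> //]].
    by apply/andP; split; apply/eqP => E; move: zY z'Y; rewrite -E tY.
  have -> : k.*2.+1 = size [:: z', z, y & p] by rewrite /= sp; move: k1; clear; lia.
  apply: cycle_copy => //.
    rewrite [uniq _]/= -/(uniq (y :: p)) up andbT.
    apply/andP; split; last by apply/negP => /nz; rewrite eqxx.
    rewrite in_cons eq_sym (negPf zz') /=.
    by apply/negP => /nz; rewrite eqxx andbF.
  by rewrite /= rcons_path pp lp Bzy Bsym Bzz' Bsym.
have clZ : {in Z &, forall x y, x != y -> G x y}.
  by move=> x y xZ yZ /BG; apply; have /exists_inPn := noZ x xZ; apply.
left.
case: (leqP #|V| #|Z|) => [leZ|ltZ]; first exact: clique_copy clZ leZ V0.
case: (leqP #|V| #|Y|) => [leY|ltY]; first exact: clique_copy clY leY V0.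
have [c cP] := tree_coloring Ttree V0.
have [b leL] := low_degree_class c Ttree V1.
(* [r] vertices are missing from [Y]. As [r] is at most a quarter of $|V|$, one colour class has [r]
   vertices of degree at most 2; as $|Z| < |V|$, at least [r] vertices of [W] lie outside [Y] and
   [Z]. *)
pose r := #|V| - #|Y|.
have [J sJ cJ] := @choose_subset V [set x | (c x == b) && (deg T x <= 2)] r ltac:(rewrite /r; lia).
have [X' sX cX] : exists2 X' : {set W}, X' \subset ~: (Y :|: Z) & #|X'| = r.
  apply: choose_subset; have := cardsC (Y :|: Z).
  have := (leq_card_setU Y Z).1; rewrite /r; lia.
(* [Sp] collects the blue neighbours in [Y] of the added vertices, at most one for each. The at most
   $2r$ neighbours of [J] must avoid it, and there is room because $3r \le |Y|$. *)
pose Sp := \bigcup_(x in X') [set y in Y | B x y].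
have cSp : #|Sp| <= r.
  rewrite -cX -[X in _ <= X]mul1n; apply: leq_card_bigcup_const => x /(subsetP sX).
  by rewrite !inE negb_or => /andP[-> /=]; rewrite -leqNgt.
have JP j : j \in J -> c j = b /\ deg T j <= 2.
  by move/(subsetP sJ); rewrite inE => /andP[/eqP].
have indJ : {in J &, forall i j, ~~ T i j}.
  by move=> i j /JP[ci _] /JP[cj _]; apply/negP => /cP; rewrite ci cj eqxx.
have cN : #|nbhd T J| <= 2 * r.
  by rewrite -cJ; apply: leq_card_bigcup_const => j /JP[].
have sN : nbhd T J \subset ~: J.
  apply/subsetP => u /nbhdP[j jJ Tju]; rewrite inE.
  by apply: contraTN Tju; apply: indJ.
have sSp : Sp \subset Y by apply/bigcupsP => x _; apply/subsetP => y; rewrite inE => /andP[].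
have Yr : #|Y :\: Sp| = #|Y| - #|Sp| by rewrite cardsDS.
have /card_gt0P[w0 _] : 0 < #|Y| by lia.
have [||||f0 [_ f0i f0Y]] := @inj_extend V W set0 (nbhd T J) (Y :\: Sp) (fun=> w0);
  rewrite ?sub0set //; try by move=> u; rewrite inE.
  by rewrite Yr; apply: leq_trans cN _; rewrite /r in cSp *; lia.
have [||f [f1 fi fY]] := @inj_extend V W (nbhd T J) (~: J) Y f0 sN f0i.
- by move=> u /f0Y; rewrite inE => /andP[].
- by have := cardsC J; rewrite cJ /r; lia.
have [||||x [_ xi xX]] := @inj_extend V W set0 J X' (fun=> w0);
  rewrite ?sub0set ?cJ ?cX //; try by move=> u; rewrite inE.
apply: (@patch_copy V W T G J X' Y f x) => //.
- rewrite disjoint_sym -setI_eq0; apply/eqP/setP => t; rewrite !inE.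
  by apply/negP => /andP[tY /(subsetP sX)]; rewrite !inE tY.
- move=> u v uJ vJ Tuv; apply: clY; rewrite ?fY //.
  by apply: contraTneq Tuv => /fi -> //; rewrite Tirr.
- move=> j u jJ Tju.
  have uN : u \in nbhd T J by apply/nbhdP; exists j.
  have := f0Y _ uN; rewrite -f1 // inE => /andP[nSp fuY].
  have xj := xX j jJ.
  apply: BG.
    by apply: contraTneq (subsetP sX _ xj) => ->; rewrite !inE fuY.
  apply: contraNN nSp => Bxf; apply/bigcupP; exists (x j) => //.
  by rewrite inE fuY.
Qed.

(** * Tree copies built on leaves or on disjoint neighbourhoods *)

(* If a family J cannot be enlarged, every vertex of degree at most 2 in the class
   is at distance at most 2 from J; the excess of the degrees over 2 being
   bounded by the number of leaves, these vertices are few. *)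
Lemma disjoint_nbhd_family (V : finType) (T : rel V) (c : V -> bool) (b : bool) r :
  is_tree T -> 1 < #|V| -> (forall x y, T x y -> c x != c y) ->
  8 * r + 5 * #|[set x | deg T x <= 1]| <= #|V| ->
  exists J : {set V}, [/\ J \subset [set x | (c x == b) && (deg T x <= 2)],
    #|J| = r & {in J &, forall i j u, T i u -> T j u -> i = j}].
Proof.
move=> Ttree V1 cP; have [[Tsym Tirr] _ _] := Ttree.
set C := [set x | _ && _].
elim: r => [|r IH] ltV.
  by exists set0; split; rewrite ?sub0set ?cards0 // => i j; rewrite inE.
have {IH} [|J [sJ cJ disJ]] := IH; first lia.
have JC j : j \in J -> deg T j <= 2 by move/(subsetP sJ); rewrite inE => /andP[].
case: (boolP (C \subset nbhd T (nbhd T J))) => [subC|/subsetPn[q qC qN]]; last first.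
  have qdis j u : j \in J -> T j u -> T q u -> False.
    move=> jJ Tju Tqu; case/negP: qN; apply/nbhdP.
    by exists u; [apply/nbhdP; exists j|rewrite Tsym].
  have qJ : q \notin J.
    have /card_gt0P[u] := tree_deg_gt0 q Ttree V1; rewrite inE => Tqu.
    by apply/negP => qJ; apply: (qdis q u).
  exists (q |: J); split.
  - by rewrite subUset sub1set qC sJ.
  - by rewrite cardsU1 qJ cJ.
  - move=> i j; rewrite !inE => /orP[/eqP->|iJ] /orP[/eqP->|jJ] u Tiu Tju //.
    + by case: (qdis j u).
    + by case: (qdis i u).
    + exact: disJ Tiu Tju.
have := tree_leaf_count Ttree V1; set E := \sum_x _ => EL.
have leE (A : pred V) : \sum_(x | A x) deg T x <= 2 * #|[set x | A x]| + E.
  apply: (@leq_trans (\sum_(x | A x) (2 + (deg T x - 2)))).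
    by apply: leq_sum => x _; rewrite addnC; lia.
  rewrite big_split /= sum_nat_const mulnC cardsE leq_add2l.
  by rewrite /E [X in _ <= X](bigID A) /= leq_addr.
have le1 : #|nbhd T J| <= 2 * r.
  by rewrite -cJ; apply: leq_card_bigcup_const => j /JC.
have le2 : #|C| <= 2 * #|nbhd T J| + E.
  apply: leq_trans (leq_card_subset subC) _.
  apply: leq_trans (leq_card_bigcup _ _) _.
  apply: leq_trans (leE (mem (nbhd T J))) _.
  rewrite leq_add2r leq_mul2l /=; apply: leq_card_subset.
  by apply/subsetP => x; rewrite inE.
have le3 : #|[set x | c x == b]| <= #|C| + #|[set x | 2 < deg T x]|.
  apply: leq_trans (leq_card_setU _ _).1.
  by apply: leq_card_subset; apply/subsetP => x; rewrite !inE => ->; case: leqP.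
have le4 := tree_branch_count Ttree V1.
have le5 := tree_color_degree b Ttree (ltnW V1) cP.
(* With $\ell$ leaves the excess [E] is $\ell - 2$, so the class has at most $4r + 2(\ell - 2)$
   vertices and $|V| - 1 \le 8r + 5(\ell - 2)$. This is the origin of the coefficients 8 and 5. *)
have := leE (fun x => c x == b); lia.
Qed.

(** The class opposite to [J] is placed in [F] first. Each leaf in [J] then has a single neighbour,
    already placed, whose image has at least $|J|$ red neighbours in [D]; distinct ones are picked
    greedily. *)
Lemma leaf_copy (V W : finType) (T : rel V) (G : rel W) (c : V -> bool)
    (b : bool) (J : {set V}) (F U D : {set W}) :
  is_tree T -> 1 < #|V| -> symmetric G -> (forall u v, T u v -> c u != c v) ->
  J \subset [set v | (c v == b) && (deg T v <= 1)] ->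
  [disjoint F & U] -> [disjoint D & F :|: U] ->
  {in F & U, forall y z, G y z} ->
  {in F, forall w, #|J| <= #|[set z in D | G w z]|} ->
  0 < #|W| ->
  #|[set v | c v != b]| <= #|F| -> #|[set v | c v == b]| <= #|U| + #|J| ->
  contains_copy T G.
Proof.
move=> Ttree V1 Gsym cP sJ disFU disD GFU degF W0 leF leU.
have [[Tsym Tirr] _ _] := Ttree.
have /card_gt0P[w0 _] := W0.
have JP j : j \in J -> c j = b /\ deg T j <= 1.
  by move/(subsetP sJ); rewrite inE => /andP[/eqP].
have [||||f [_ fi fF]] := @inj_extend V W set0 [set v | c v != b] F (fun=> w0);
  rewrite ?sub0set //; try by move=> u; rewrite inE.
pose C j := [set z in D | [forall u, T j u ==> G z (f u)]].
have [|x [xi xC]] := @greedy_choice V W J C w0.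
  move=> j jJ; have [cj dj] := JP j jJ.
  have /cards1P[u Nj] : #|[set u | T j u]| == 1.
    by rewrite eqn_leq dj tree_deg_gt0.
  have Tju : T j u by have := set11 u; rewrite -Nj inE.
  have fuF : f u \in F by apply: fF; rewrite inE -cj eq_sym cP.
  apply: leq_trans (degF _ fuF) _; apply: leq_card_subset.
  apply/subsetP => z; rewrite !inE => /andP[-> Gfz] /=.
  apply/forallP => u'; apply/implyP => Tju'.
  have : u' \in [set u] by rewrite -Nj inE.
  by rewrite inE => /eqP->; rewrite Gsym.
apply: (@bipartite_copy V W T G c b J F U D f x) => //.
- by apply: subset_trans sJ _; apply/subsetP => v; rewrite !inE => /andP[].
- rewrite cardsDS; first by rewrite leq_subLR addnC.
  by apply: subset_trans sJ _; apply/subsetP => v; rewrite !inE => /andP[].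
- by move=> j /xC; rewrite inE => /andP[].
- by move=> j u /xC; rewrite inE => /andP[_ /forallP/(_ u)/implyP].
Qed.

(** The vertices of [J] are placed on [X] one at a time, each together with its at most two
    neighbours, which go to red neighbours in [F]. Disjointness means that none of these neighbours
    was placed before, and fewer than $2|J| - 1$ vertices of [F] are occupied at any step. The rest
    of the opposite class is added last. *)
Lemma disjoint_nbhd_copy (V W : finType) (T : rel V) (G : rel W) (c : V -> bool)
    (b : bool) (J : {set V}) (F U X : {set W}) :
  symmetric T -> symmetric G -> (forall u v, T u v -> c u != c v) ->
  J \subset [set v | (c v == b) && (deg T v <= 2)] ->
  {in J &, forall i j u, T i u -> T j u -> i = j} ->
  [disjoint F & U] -> [disjoint X & F :|: U] ->
  {in F & U, forall y z, G y z} ->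
  #|J| <= #|X| ->
  {in X, forall x, 2 * #|J| <= #|[set w in F | G x w]|} ->
  0 < #|W| ->
  #|[set v | c v != b]| <= #|F| -> #|[set v | c v == b]| <= #|U| + #|J| ->
  contains_copy T G.
Proof.
move=> Tsym Gsym cP sJ disJ disFU disX GFU leX degX W0 leF leU.
have /card_gt0P[w0 _] := W0.
have JP j : j \in J -> c j = b /\ deg T j <= 2.
  by move/(subsetP sJ); rewrite inE => /andP[/eqP].
pose P (K : {set V}) := exists (x f : V -> W),
  [/\ {in K &, injective x}, {in K, forall j, x j \in X},
      {in nbhd T K &, injective f}, {in nbhd T K, forall u, f u \in F} &
      forall j u, j \in K -> T j u -> G (x j) (f u)].
have [x [f [xi xX fi fF xf]]] : P J.
  apply: set_grow_ind => [|K w sK wJ wK [x [f [xi xX fi fF xf]]]].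
    exists (fun=> w0), (fun=> w0); split=> // u; rewrite ?inE //.
    - by move=> v /nbhdP[j]; rewrite inE.
    - by case/nbhdP => j; rewrite inE.
  have ltKJ : #|K| < #|J| by apply/proper_card/properP; split=> //; exists w.
  have /subsetPn[z zX zK] : ~~ (X \subset x @: K).
    apply: contraTN leX => /leq_card_subset le1; rewrite -ltnNge.
    by rewrite (leq_ltn_trans le1) // (leq_ltn_trans (leq_imset_card _ _)).
  pose E := [set v in F | G z v] :\: f @: nbhd T K.
  have leN : #|f @: nbhd T K| <= 2 * #|K|.
    apply: leq_trans (leq_imset_card _ _) _.
    by apply: leq_card_bigcup_const => j /(subsetP sK)/JP[].
  have leE : #|[set u | T w u]| <= #|E|.
    have [_ dw] := JP _ wJ; apply: leq_trans dw _.
    rewrite /E cardsD; have := degX z zX.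
    have := leq_card_subset (subsetIr [set v in F | G z v] (f @: nbhd T K)).
    lia.
  have [||||g [_ gi gE]] := @inj_extend V W set0 [set u | T w u] E (fun=> w0);
    rewrite ?sub0set //; try by move=> u; rewrite inE.
  have xz j : j \in K -> x j != z by move=> jK; apply: contraNneq zK => <-; apply: imset_f.
  have gEP u : T w u -> [/\ g u \in F, G z (g u) & forall v, v \in nbhd T K -> g u <> f v].
    move=> Twu; have : g u \in E by apply: gE; rewrite inE.
    rewrite !inE => /and3P[gN -> ->]; split=> // v vN eqg.
    by case/negP: gN; rewrite eqg imset_f.
  have NP u : u \in nbhd T (w |: K) -> ~~ T w u -> u \in nbhd T K.
    case/nbhdP=> j; rewrite !inE => /orP[/eqP-> -> //|jK Tju _].
    by apply/nbhdP; exists j.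
  exists (fun j => if j == w then z else x j), (fun u => if T w u then g u else f u).
  split.
  - move=> i j; rewrite !inE; case: eqVneq => [->|iw]; case: eqVneq => [->|jw] //= iK jK.
    + by move/esym/eqP; rewrite (negPf (xz _ _)).
    + by move/eqP; rewrite (negPf (xz _ _)).
    + exact: xi.
  - by move=> j; rewrite !inE; case: eqVneq => //= _ /xX.
  - move=> u v uN vN; case: (boolP (T w u)) => Twu; case: (boolP (T w v)) => Twv.
    + by apply: gi; rewrite inE.
    + by have [_ _ H] := gEP u Twu => /H; case; apply: NP.
    + by have [_ _ H] := gEP v Twv => /esym/H; case; apply: NP.
    + by apply: fi; apply: NP.
  - move=> u uN; case: (boolP (T w u)) => Twu; first by have [] := gEP u Twu.
    by apply: fF; apply: NP.
  - move=> j u; rewrite !inE; case: eqVneq => [->|jw] /=.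
      by move=> _ Twu; rewrite Twu; have [] := gEP u Twu.
    move=> jK Tju; case: (boolP (T w u)) => Twu; last exact: xf.
    by have := disJ _ _ (subsetP sK _ jK) wJ u Tju Twu => /eqP; rewrite (negPf jw).
have sN : nbhd T J \subset [set v | c v != b].
  apply/subsetP => u /nbhdP[j /JP[cj _] Tju].
  by rewrite inE -cj eq_sym cP.
have [f' [f'E f'i f'F]] := inj_extend sN fi fF leF.
have sJc : J \subset [set v | c v == b].
  by apply: subset_trans sJ _; apply/subsetP => v; rewrite !inE => /andP[].
apply: (@bipartite_copy V W T G c b J F U X f' x) => //.
- by rewrite cardsDS // leq_subLR addnC.
- by move=> j u jJ Tju; rewrite f'E ?xf //; apply/nbhdP; exists j.
Qed.

(** * The upper bound *)

(** The red edges between [X] and [S] number at least $|X||S|/3$ and at most $d|S|$. *)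
Lemma double_count (W : finType) (G : rel W) (S X D : {set W}) d :
  symmetric G -> X \subset D -> 0 < #|S| ->
  {in X, forall x, #|S| <= 3 * #|[set a in S | G x a]|} ->
  {in S, forall a, #|[set x in D | G a x]| <= d} -> #|X| <= 3 * d.
Proof.
move=> Gsym sX S0 leX leS; rewrite -(leq_pmul2r S0) -sum_nat_const.
apply: (@leq_trans (\sum_(x in X) 3 * #|[set a in S | G x a]|)); first exact: leq_sum.
rewrite -big_distrr /= -mulnA leq_mul2l /=.
have cnt (A : {set W}) x : #|[set a in A | G x a]| = \sum_(a in A) G x a.
  rewrite -sum1_card big_mkcond [RHS]big_mkcond /=; apply: eq_bigr => a _.
  by rewrite inE; case: (a \in A) => //=; case: (G x a).
under eq_bigr => x _ do rewrite cnt.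
rewrite exchange_big /= mulnC -sum_nat_const; apply: leq_sum => a aS.
apply: leq_trans (leS a aS); rewrite cnt.
rewrite [X in _ <= X](bigID (mem X)) /=; apply: leq_trans (leq_addr _ _).
rewrite [X in _ <= X](eq_bigl (mem X)); last first.
  by move=> x; apply: andb_idl; apply: (subsetP sX).
by apply: leq_sum => x _; rewrite Gsym.
Qed.

Lemma card_color_class (V : finType) (c : V -> bool) b :
  #|[set v | c v == b]| + #|[set v | c v != b]| = #|V|.
Proof.
have -> : [set v | c v != b] = ~: [set v | c v == b] by apply/setP => v; rewrite !inE.
exact: cardsC.
Qed.

(** Put $n = |V|$. If all red degrees are at least $n - 1$, the tree embeds greedily; a vertex of
    smaller red degree has at least $(2n - 1) - 1 - (n - 2) = n$ blue neighbours. *)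
Lemma large_compl_degree (V W : finType) (T : rel V) (G : rel W) :
  is_tree T -> simple_graph G -> 0 < #|V| -> 2 * #|V| - 1 <= #|W| ->
  contains_copy T G \/ exists v, #|V| <= #|[set w | compl_graph G v w]|.
Proof.
move=> Ttree Gsimple V0 leW.
case: (boolP [forall w, #|V| <= (deg G w).+1]) => [/forallP degG|].
  by left; apply: greedy_embedding => //; lia.
rewrite negb_forall => /existsP[v]; rewrite -ltnNge => ltd; right; exists v.
have -> : [set w | compl_graph G v w] = ~: (v |: [set w | G v w]).
  by apply/setP => w; rewrite !inE /compl_graph negb_or eq_sym.
have := cardsC (v |: [set w | G v w]); rewrite cardsU1.
by have := leq_b1 (v \notin [set w | G v w]); move: ltd; rewrite /deg; lia.
Qed.

(** A blue edge among the blue neighbours of [v] closes a triangle with [v]; without one they form a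
    red clique large enough for the tree. *)
Lemma triangle_case (V W : finType) (T : rel V) (G : rel W) :
  is_tree T -> simple_graph G -> 0 < #|V| -> 2 * #|V| - 1 <= #|W| ->
  contains_copy T G \/ contains_copy (cycle_graph 3) (compl_graph G).
Proof.
move=> Ttree Gsimple V0 leW; have [[_ Tirr] _ _] := Ttree.
have Bsym := compl_graph_sym Gsimple.1.
have [|[v leA]] := large_compl_degree Ttree Gsimple V0 leW; first by left.
set A := [set w | _] in leA.
case: (boolP [exists a in A, [exists b in A, compl_graph G a b]]) => [|/exists_inPn noA].
  case/exists_inP=> a; rewrite inE => va /exists_inP[b]; rewrite inE => vb ab; right.
  have ne x y : compl_graph G x y -> x != y by case/andP.
  apply: (@cycle_copy W _ [:: v; a; b]) => //=.
    by rewrite !inE negb_or !ne.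
  by rewrite va ab Bsym vb.
left; apply: (clique_copy (K := A)) => // a b aA bA ab.
have /exists_inPn/(_ b bA) := noA a aA.
by rewrite /compl_graph ab negbK.
Qed.

Lemma longer_cycle_case (V W : finType) (T : rel V) (G : rel W) (k : nat) :
  is_tree T -> simple_graph G -> 1 < k -> 50 * k.*2.+1 <= #|V| ->
  2 * #|V| - 1 <= #|W| ->
  contains_copy T G \/ contains_copy (cycle_graph k.*2.+1) (compl_graph G).
Proof.
move=> Ttree Gsimple k1 leV leW.
have [Gsym Girr] := Gsimple; have [[Tsym Tirr] _ _] := Ttree.
have Bsym : symmetric (compl_graph G) := compl_graph_sym Gsym.
have V1 : 1 < #|V| by move: leV; clear; lia.
have V0 := ltnW V1.
have W0 : 0 < #|W| by move: V1 leW; clear; lia.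
have [c cP] := tree_coloring Ttree V0.
have [|[v leA]] := large_compl_degree Ttree Gsimple V0 leW; first by left.
have [A sA cA] := choose_subset leA.
have [B0 sB0 cB0] : exists2 B0 : {set W}, B0 \subset ~: A & #|B0| = #|V|.-1.
  by apply: choose_subset; have := cardsC A; move: V1 leW; rewrite cA; clear; lia.
have vA (s : seq W) : {subset s <= A} -> forall w, w \in s -> compl_graph G v w.
  by move=> ss w /ss/(subsetP sA); rewrite inE.
(* A blue path on $2k$ vertices of [A] would close with [v] to a blue cycle of length $2k + 1$. *)
case: (boolP [exists t : k.*2.-tuple W,
    [&& uniq t, all (mem A) t & sorted (compl_graph G) t]]).
  case/existsP=> t /and3P[ut /allP tA st]; right.
  have vt : v \notin (t : seq W).
    by apply/negP => vt; have := vA _ tA v vt; rewrite /compl_graph eqxx.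
  have := size_tuple t; case: (tval t) ut tA st vt => [|x p] ut tA st vt szt.
    by move: szt k1; case: (k).
  rewrite -szt; apply: (@cycle_copy W _ (v :: x :: p)) => //.
    by rewrite [uniq _]/= -/(uniq (x :: p)) vt ut.
  rewrite /= rcons_path (vA _ tA) ?mem_head //= Bsym (vA _ tA) ?andbT //.
  exact: mem_last.
rewrite negb_exists => /forallP not.
have short (s : seq W) : uniq s -> {subset s <= A} -> sorted (compl_graph G) s ->
    size s <= k.*2.-1.
  move=> us ss pths; rewrite leqNgt; apply/negP => lts.
  have sz : size (take k.*2 s) == k.*2.
    by rewrite size_take_min; move: lts k1; clear; lia.
  case/negP: (not (Tuple sz)); rewrite /= take_uniq // take_sorted // andbT.
  by apply/allP => x /mem_take/ss.
clear not.
have split (A' : {set W}) f : A' \subset A -> f <= #|A'| ->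
  exists F U : {set W}, [/\ F \subset A', U \subset A', [disjoint F & U], #|F| = f
    & #|A'| <= f + #|U| + k.*2.-1 /\ {in F & U, forall x y, G x y}].
  move=> sA' lef.
  have [s us ss|F [U [sF sU dFU cF [leFU sep]]]] := @dfs_split W _ A' k.*2.-1 f Bsym _ lef.
    by apply: short => // x /ss; apply: (subsetP sA').
  exists F, U; split=> //; split=> // x y xF yU; have := sep x y xF yU.
  rewrite /compl_graph negb_and !negbK => /orP[/eqP E|//].
  by have /setP/(_ x) := disjoint_setI0 dFU; rewrite !inE xF E yU.
have AB x : x \in A -> x \in B0 -> False.
  by move=> xA /(subsetP sB0); rewrite inE xA.
pose X (S : {set W}) := [set x in B0 | #|S| <= 3 * #|[set a in S | G x a]|].
(* Two vertices of [B0] outside [X S] are each red to less than a third of [S], so they share more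
   than $|S|/3 \ge k + 2$ blue neighbours there. The first alternative says exactly that [B0] minus
   [X S] has fewer than $3|V|/4$ vertices. *)
have robust (S : {set W}) : S \subset A -> 3 * k.+2 <= #|S| ->
    #|V| < 4 * #|X S|.+1 \/ contains_copy T G \/
    contains_copy (cycle_graph k.*2.+1) (compl_graph G).
  move=> sS leS; case: (ltnP #|V| (4 * #|X S|.+1)) => leX; [by left|right].
  have sX : X S \subset B0 by apply/subsetP => x; rewrite inE => /andP[].
  have cY : #|B0 :\: X S| = #|V|.-1 - #|X S| by rewrite cardsDS // cB0.
  apply: (@robust_clique V W T G k (B0 :\: X S) S) => //.
  - rewrite -setI_eq0; apply/eqP/setP => x; rewrite !inE.
    by apply/negP => /andP[/andP[_ xB] /(subsetP sS)/AB]; apply.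
  - by rewrite cY; move: leX leV; clear; lia.
  - by rewrite cY; move: leX leV; clear; lia.
  move=> u w; rewrite !inE => /andP[uX uB] /andP[wX wB] _.
  move: uX wX; rewrite uB wB /= -!ltnNge => uX wX.
  pose N x := [set a in S | G x a].
  have ne x a : x \in B0 -> a \in S -> x != a.
    by move=> xB aS; apply/eqP => E; apply: (@AB x) => //; rewrite E; apply: (subsetP sS).
  have : #|S| <= #|N u :|: N w| + #|[set s in S | compl_graph G u s && compl_graph G w s]|.
    apply: leq_trans (leq_card_setU _ _).1.
    apply: leq_card_subset; apply/subsetP => s sS'; rewrite !inE /compl_graph sS' !ne //=.
    by case: (G u s); case: (G w s).
  have := (leq_card_setU (N u) (N w)).1; rewrite -!/(N _) in uX wX.
  by move: #|N u| #|N w| #|N u :|: N w| uX wX leS; clear; lia.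
pose leaf b := [set x | (c x == b) && (deg T x <= 1)].
(* g exceeds the loss 3k + 5 of the bad set S plus the loss 2k - 1 of the split. *)
pose g := 5 * k + 5.
case: (boolP [exists b, g <= #|leaf b|]) => [/existsP[b leg]|].
  have [J sJ cJ] := choose_subset leg.
  (* The vertices of [A] with too few red neighbours in [B0] for attaching [g] leaves. If they were
     at least [3 * k.+2], double counting would bound [X S] by [3 * g.-1], too small for the
     alternative given by [robust]. *)
  pose S := [set a in A | #|[set x in B0 | G a x]| < g].
  have sSA : S \subset A by apply/subsetP => x; rewrite inE => /andP[].
  case: (leqP (3 * k.+2) #|S|) => leS.
    case: (robust S sSA leS) => // ltX.
    have : #|X S| <= 3 * g.-1.
      apply: (@double_count W G S (X S) B0) => //.
      - by apply/subsetP => x; rewrite inE => /andP[].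
      - by move: leS; clear; lia.
      - by move=> x; rewrite inE => /andP[].
      - by move=> a; rewrite inE => /andP[_]; rewrite /g; clear; lia.
    by rewrite /g; move: k1 leV ltX; clear; lia.
  have cAS : #|A :\: S| = #|V| - #|S| by rewrite cardsDS // cA.
  have cc := card_color_class c b.
  have leb : #|leaf b| <= #|[set v | c v == b]|.
    by apply: leq_card_subset; apply/subsetP => x; rewrite !inE => /andP[].
  have sAS : A :\: S \subset A by apply: subsetDl.
  have [|F [U [sF sU dFU cF [leFU GFU]]]] := split (A :\: S) #|[set v | c v != b]| sAS.
    by rewrite cAS; move: leS leb leg cc; rewrite /g; clear; lia.
  left; apply: (@leaf_copy V W T G c b J F U B0) => //.
  - rewrite -setI_eq0; apply/eqP/setP => x; rewrite !inE.
    apply/negP => /andP[xB /orP[/(subsetP sF)|/(subsetP sU)]];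
    by rewrite inE => /andP[_ /AB]; apply.
  - move=> w /(subsetP sF); rewrite inE => /andP[wS wA].
    by move: wS; rewrite inE wA /= -leqNgt cJ.
  - by rewrite cF.
  - rewrite cJ; move: leFU; rewrite cAS; move: leS cc; rewrite /g; clear; lia.
rewrite negb_exists => /forallP few.
have leL : #|[set x | deg T x <= 1]| <= 2 * g.-1.
  have -> : [set x | deg T x <= 1] = leaf true :|: leaf false.
    by apply/setP => x; rewrite !inE -andb_orl; case: (c x).
  apply: leq_trans (leq_card_setU _ _).1 _.
  by have := few true; have := few false; rewrite -!ltnNge /g; clear; lia.
(* r is twice the loss 2k - 1 of one split, because F may have to be enlarged by a
   second split. *)
pose r := 4 * k - 2.
have family b := @disjoint_nbhd_family V T c b r Ttree V1 cP.
have {}family b : exists J : {set V}, [/\ J \subset [set x | (c x == b) && (deg T x <= 2)],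
    #|J| = r & {in J &, forall i j u, T i u -> T j u -> i = j}].
  by apply: family; move: leL leV; rewrite /g /r; clear; lia.
have classr b : r <= #|[set v | c v == b]|.
  have [J [sJ <- _]] := family b; apply: leq_card_subset; apply: subset_trans sJ _.
  by apply/subsetP => x; rewrite !inE => /andP[].
have [|ltX|] := robust A (subxx _); last by [].
  by rewrite cA; move: leV k1; clear; lia.
have neT : [set v | c v != true] = [set v | c v == false].
  by apply/setP => x; rewrite !inE; case: (c x).
have cc := card_color_class c true; rewrite neT in cc.
pose d := k.*2.-1.
(* The prescribed size of [F] puts the whole loss [d] of the split on the class [true]: [U] then has
   room for the entire class [false]. *)
have [|F [U [sF sU dFU cF [leFU GFU]]]] := split A (#|[set v | c v == true]| - d) (subxx _).
  by rewrite cA -cc; clear; lia.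
(* A vertex of [X A] thus has at least [2 * r] red neighbours in [F] or at least that many in
   [U]. *)
have degX x : x \in X A ->
    4 * r <= #|[set a in F | G x a]| + #|[set a in U | G x a]|.
  rewrite inE cA => /andP[_ degA].
  have : #|[set a in A | G x a]| <=
      #|[set a in F | G x a] :|: [set a in U | G x a]| + #|A :\: (F :|: U)|.
    apply: leq_trans (leq_card_setU _ _).1.
    apply: leq_card_subset; apply/subsetP => a; rewrite !inE => /andP[-> ->].
    by rewrite !andbT; case: (a \in F); case: (a \in U).
  have := (leq_card_setU [set a in F | G x a] [set a in U | G x a]).1.
  have -> : #|A :\: (F :|: U)| = #|A| - (#|F| + #|U|).
    rewrite cardsDS; last by rewrite subUset sF sU.
    by rewrite cardsU (disjoint_setI0 dFU) cards0 subn0.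
  move: leFU degA; rewrite cA cF -/d.
  move: #|[set a in A | G x a]| #|[set a in F | G x a]| #|[set a in U | G x a]|.
  move: #|_ :|: _| #|U| (#|_| - d) leV; rewrite /d /r; clear; lia.
have XF : X A \subset B0 by apply/subsetP => x; rewrite inE => /andP[].
have GUF : {in U & F, forall x y, G x y} by move=> x y xU yF; rewrite Gsym GFU.
have dUF : [disjoint U & F] by rewrite disjoint_sym.
have disX (Z F' U' : {set W}) : Z \subset X A -> F' \subset A -> U' \subset A ->
    [disjoint Z & F' :|: U'].
  move=> sZ sF' sU'; rewrite -setI_eq0; apply/eqP/setP => x; rewrite !inE.
  apply/negP => /andP[/(subsetP sZ)/(subsetP XF) xB].
  by case/orP => [/(subsetP sF')|/(subsetP sU')] /AB; apply.
(* Placing J on vertices of X needs the other colour class on the side where they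
   have their red neighbours. *)
pose XU := [set x in X A | 2 * r <= #|[set a in U | G x a]|].
left; case: (leqP r #|XU|) => leXU.
  have [J [sJ cJ disJ]] := family true.
  apply: (@disjoint_nbhd_copy V W T G c true J U F XU) => //.
  - by apply: disX => //; apply/subsetP => x; rewrite inE => /andP[].
  - by rewrite cJ.
  - by move=> x; rewrite inE cJ => /andP[].
  - by have := classr true; move: leFU cc k1; rewrite neT cA /d /r; clear; lia.
  - by have := classr true; move: k1; rewrite cF cJ /d /r; clear; lia.
(* [F'] supplies the [d] vertices that [F] lacks for the class [true]. What remains in [U'] falls
   short of the class [false] by at most $2d = r$, the size of [J]. *)
have [|F' [U' [sF' sU' dFU' cF' [leFU' GFU']]]] := split U d sU.
  have := classr false; have := classr true; move: leFU cc leV; rewrite cA /d /r; clear; lia.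
have [J [sJ cJ disJ]] := family false.
apply: (@disjoint_nbhd_copy V W T G c false J (F :|: F') U' (X A :\: XU)) => //.
- rewrite -setI_eq0; apply/eqP/setP => x; rewrite !inE.
  apply/negP => /andP[/orP[xF /(subsetP sU') xU|xF xU]].
    by have /setP/(_ x) := disjoint_setI0 dFU; rewrite !inE xF xU.
  by have /setP/(_ x) := disjoint_setI0 dFU'; rewrite !inE xF xU.
- apply: disX; first exact: subsetDl.
    by rewrite subUset sF (subset_trans sF').
  exact: subset_trans sU' sU.
- by move=> x y; rewrite inE => /orP[xF /(subsetP sU')|]; [apply: GFU|apply: GFU'].
- rewrite cJ cardsDS; last by apply/subsetP => x; rewrite inE => /andP[].
  by move: leXU ltX leV; rewrite /r; clear; lia.
- move=> x; rewrite !inE cJ => /andP[xU xX].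
  have xA : x \in X A by rewrite inE.
  have := degX x xA; move: xU; rewrite xX /= -ltnNge.
  have : #|[set a in F | G x a]| <= #|[set a in F :|: F' | G x a]|.
    by apply: leq_card_subset; apply/subsetP => a; rewrite !inE => /andP[-> ->].
  by clear; lia.
- rewrite cardsU; have -> : F :&: F' = set0.
    apply/setP => x; rewrite !inE; apply/negP => /andP[xF /(subsetP sF') xU].
    by have /setP/(_ x) := disjoint_setI0 dFU; rewrite !inE xF xU.
  have -> : [set v | c v != false] = [set v | c v == true].
    by apply/setP => x; rewrite !inE; case: (c x).
  by rewrite cards0 cF cF'; clear; lia.
- move: cc leFU leFU' (classr true) k1; rewrite cA cJ /d /r; clear; lia.
Qed.

(** * The lower bound: two disjoint cliques *)

Definition two_cliques (r : nat) : rel (bool * 'I_r) :=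
  fun x y => (x.1 == y.1) && (x != y).

Lemma two_cliques_simple r : simple_graph (@two_cliques r).
Proof.
by split=> [x y|x]; rewrite /two_cliques ?eqxx ?andbF // eq_sym [y == x]eq_sym.
Qed.

(** A copy of a connected graph stays inside one clique, where the second component alone tells the
    vertices apart. *)
Lemma two_cliques_no_connected (V : finType) (T : rel V) r :
  connected_graph T -> r < #|V| -> ~ contains_copy T (@two_cliques r).
Proof.
move=> Tconn ltr [f [fi fT]].
have side x y : (f x).1 = (f y).1.
  have /connectP[p pth ->] := Tconn x y.
  elim: p x pth => //= z p IH x /andP[/fT/andP[/eqP-> _] /IH].
  by [].
suff : #|V| <= r by rewrite leqNgt ltr.
rewrite -[r]card_ord; apply: (@leq_card _ _ (fun x => (f x).2)) => x y eq2.
by apply: fi; rewrite [f x]surjective_pairing [f y]surjective_pairing eq2 (side x y).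
Qed.

(** The complement is bipartite: the side alternates along the cycle, and the edge from the last
    vertex back to the first contradicts odd length. *)
Lemma compl_two_cliques_no_odd_cycle m r :
  odd m -> 1 < m -> ~ contains_copy (cycle_graph m) (compl_graph (@two_cliques r)).
Proof.
case: m => // m oddm lt1m [f [fi fC]].
have step (i j : 'I_m.+1) : cycle_graph m.+1 i j -> (f j).1 = ~~ (f i).1.
  move=> Cij; have /andP[neq] := fC i j Cij; rewrite /two_cliques neq andbT.
  by case: (f i).1; case: (f j).1.
have alt i (lti : i < m.+1) : (f (Ordinal lti)).1 = odd i (+) (f ord0).1.
  elim: i lti => [|i IH] lti; first by congr (f _).1; apply: val_inj.
  rewrite (step (Ordinal (ltnW lti))) ?IH //=; first by rewrite addNb.
  by rewrite /cycle_graph /= modn_small ?eqxx.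
have := step ord_max ord0.
rewrite /cycle_graph /= modnn eqxx => /(_ isT).
have -> : ord_max = Ordinal (ltnSn m) :> 'I_m.+1 by apply: val_inj.
by move: oddm => /= /negPf odm; rewrite (alt m) odm; case: (f ord0).1.
Qed.

Theorem theorem3 (m n : nat) (T : rel 'I_n) :
  odd m -> 3 <= m -> 50 * m <= n -> is_tree T ->
  ramsey_number_is T (cycle_graph m) (2 * n - 1).
Proof.
move=> oddm m3 lemn Ttree; have [_ Tconn _] := Ttree.
split; first by lia.
  move=> W G Gsimple leW.
  have -> : m = m./2.*2.+1 by have := odd_double_half m; rewrite oddm; lia.
  have [->|k1] : m./2 = 1 \/ 1 < m./2 by lia.
    by apply: triangle_case; rewrite ?card_ord //; lia.
  by apply: longer_cycle_case; rewrite ?card_ord //; lia.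
move=> N' _ ramN'; rewrite leqNgt; apply/negP => ltN'.
(* Two cliques of size $n - 1$ have $2n - 2$ vertices in all, so they refute every [N'] below $2n -
   1$. *)
have [||] := ramN' _ _ (two_cliques_simple n.-1).
- by rewrite card_prod card_bool card_ord; lia.
- by apply: two_cliques_no_connected; rewrite ?card_ord //; lia.
- by apply: compl_two_cliques_no_odd_cycle => //; apply: ltnW.
Qed.
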